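(* For any $q\in\mathbb R^+$, the semi-discrete problem $$\sum_{j\in\mathcal N_h(\Omega_i)}\mathsf M_{ij}(u_h)\,\mathrm d_t u_j+\sum_{j\in\mathcal N_h(\Omega_i)}\mathsf K_{ij}(u_h)u_j=g_i\qquad\forall i\in\mathcal N_h$$ (resp. the discrete problem $\sum_{j}\mathsf M_{ij}(u_h^{n+1})\delta_t u_j^{n+1}+\sum_j\mathsf K_{ij}(u_h^{n+1})u_j^{n+1}=g_i^{n+1}$ for all $i\in\mathcal N_h$) leads to solutions $u_h\in V_h$ that enjoy the local extremum diminishing (LED) property: for $g=0$ and any time in $(0,T]$, $\mathrm d_t u_i\le 0$ if $u_i$ is a maximum and $\mathrm d_t u_i\ge 0$ if $u_i$ is a minimum (resp. the same with $\mathrm d_t$ replaced by $\delta_t$).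
   Context: $\Omega\subset\mathbb R^d$ is a bounded domain and $\mathcal T_h$ a conforming mesh of $\Omega$ (triangles/quadrilaterals for $d=2$, tetrahedra/hexahedra for $d=3$) with set of nodes $\mathcal N_h$; node $i$ has position $\boldsymbol x_i$. $\Omega_i$ is the union of the elements having $i$ as a node, and $\mathcal N_h(\Omega_i)$ is the set of nodes in $\Omega_i$ (including $i$). $V_h$ is the continuous $P_1$ (or $Q_1$ on quadrilaterals/hexahedra) finite element space with nodal basis $\{\varphi_i\}$, and $u_h=\sum_i u_i\varphi_i$. $(\cdot,\cdot)$ is the $L^2(\Omega)$ inner product, $\boldsymbol f\in\mathrm{Lip}(\mathbb R;\mathbb R^d)$ is the flux of the conservation law $\partial_t u+\nabla\cdot\boldsymbol f(u)=g$ on $\Omega\times(0,T]$, $g_i=(g,\varphi_i)$. Galerkin convection: $\mathsf F_{ij}(w_h)=(\boldsymbol f'(w_h)\cdot\nabla\varphi_j,\varphi_i)$. Shock detector: for $j\in\mathcal N_h(\Omega_i)\setminus\{i\}$ let $\boldsymbol r_{ij}=\boldsymbol x_j-\boldsymbol x_i$; let $\boldsymbol x_{ij}^{\rm sym}$ be the point at the intersection between the line that passes through $\boldsymbol x_i$ and $\boldsymbol x_j$ and $\partial\Omega_i$ that is not $\boldsymbol x_j$; $\boldsymbol r_{ij}^{\rm sym}=\boldsymbol x_{ij}^{\rm sym}-\boldsymbol x_i$, $u_j^{\rm sym}=u_h(\boldsymbol x_{ij}^{\rm sym})$. Set $$J_{ij}=\frac{u_j-u_i}{|\boldsymbol r_{ij}|}+\frac{u_j^{\rm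 sym}-u_i}{|\boldsymbol r_{ij}^{\rm sym}|},\qquad A_{ij}=\frac12\Big(\frac{|u_j-u_i|}{|\boldsymbol r_{ij}|}+\frac{|u_j^{\rm sym}-u_i|}{|\boldsymbol r_{ij}^{\rm sym}|}\Big),$$ and, with sums over $j\in\mathcal N_h(\Omega_i)\setminus\{i\}$, $$\alpha_i(u_h)=\Big[\frac{|\sum_j J_{ij}|}{\sum_j 2A_{ij}}\Big]^q\ \text{ if }\sum_jA_{ij}\neq0,\qquad \alpha_i(u_h)=0\ \text{ otherwise.}$$ Stabilization: $\nu_{ij}(w_h)=\max\{\alpha_i(w_h)\mathsf F_{ij}(w_h),\alpha_j(w_h)\mathsf F_{ji}(w_h),0\}$ for $i\ne j$, $\nu_{ii}=\sum_{j\in\mathcal N_h(\Omega_i),j\ne i}\nu_{ij}$; $\mathsf B_{ij}(w_h)=\nu_{ij}(w_h)\,(2\delta_{ij}-1)$ for $j\in\mathcal N_h(\Omega_i)$ and $0$ otherwise; $\mathsf K=\mathsf F+\mathsf B$. Gradually lumped mass matrix: $\mathsf M_{ij}(w_h)=(1-\alpha_i(w_h))(\varphi_j,\varphi_i)+\alpha_i(w_h)\,(\delta_{ij},\varphi_i)$. Backward Euler: $\delta_t u_h^{n+1}=(u_h^{n+1}-u_h^n)/\Delta t_{n+1}$, $\Delta t_{n+1}=t^{n+1}-t^n$. $u_i$ is a maximum (minimum) if $u_i\ge u_j$ ($u_i\le u_j$) for all $j\in\mathcal N_h(\Omega_i)$.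
   Formalization: The LED sign is stated only at extremal nodes with ∑_j A_ij ≠ 0, i.e. where u_h is not constant on Ω_i; otherwise α_i = 0, the row has the consistent mass matrix, and the claim can fail (e.g. Backward Euler with linear flux, u = 1 on the patch and 0 elsewhere). *)

(* Defs.v *)
From HB Require Import structures.
From mathcomp Require Import all_boot all_order all_algebra.
From mathcomp Require Import all_classical all_reals all_analysis.

Set Implicit Arguments.
Unset Strict Implicit.
Unset Printing Implicit Defensive.

Import Order.TTheory GRing.Theory Num.Theory.
Import numFieldNormedType.Exports.

Local Open Scope classical_set_scope.
Local Open Scope ring_scope.

(* The library has no Lebesgue measure on R^d.  It is built here by induction
   on d, as an iterated product, on the measurable type d.-tuple R (whose
   sigma-algebra is the product one). *)
Section lebesgue_measure_on_tuples.
Context (R : realType).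

Definition tcons n (p : n.-tuple R * R) : n.+1.-tuple R :=
  [tuple of p.2 :: p.1].

Lemma measurable_tcons n : measurable_fun [set: n.-tuple R * R] (@tcons n).
Proof. exact: measurable_cons measurable_snd measurable_fst. Qed.

Section step.
Context n (m : {measure set (n.-tuple R) -> \bar R}).

Definition leb_step : set (n.+1.-tuple R) -> \bar R :=
  pushforward (m \x (@lebesgue_measure R))%E (@tcons n).

Let leb_step0 : leb_step set0 = 0%E.
Proof. by rewrite /leb_step /pushforward preimage_set0 measure0. Qed.

Let leb_step_ge0 A : (0 <= leb_step A)%E.
Proof. by rewrite /leb_step /pushforward; exact: measure_ge0. Qed.

Let leb_step_sigma_additive : semi_sigma_additive leb_step.
Proof.
move=> F mF tF mUF; rewrite /leb_step /pushforward preimage_bigcup.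
have mpre A : measurable A -> measurable (@tcons n @^-1` A).
  by move=> mA; rewrite -[X in measurable X]setTI; exact: measurable_tcons.
apply: measure_semi_sigma_additive.
- by move=> k; exact: mpre.
- apply/trivIsetP => /= i j _ _ ij; rewrite -preimage_setI.
  by move/trivIsetP : tF => /(_ _ _ _ _ ij) ->//; rewrite preimage_set0.
- by rewrite -preimage_bigcup; exact: mpre.
Qed.

HB.instance Definition _ := isMeasure.Build _ _ _ leb_step
  leb_step0 leb_step_ge0 leb_step_sigma_additive.

End step.

Fixpoint leb n : {measure set (n.-tuple R) -> \bar R} :=
  match n with
  | 0 => dirac [tuple]
  | n'.+1 => leb_step (leb n')
  end.

Definition point_of_tuple d (t : d.-tuple R) : 'rV[R]_d := \row_k tnth t k.

Definition integral_on d (Omega : set 'rV[R]_d) (f : 'rV[R]_d -> R) : R :=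
  \int[leb d]_(t in @point_of_tuple d @^-1` Omega) f (point_of_tuple t).

End lebesgue_measure_on_tuples.

Section geometry.
Context (R : realType) (d : nat).

(* The library norm on 'rV[R]_d is the sup norm. *)
Definition enorm (v : 'rV[R]_d) : R := Num.sqrt (\sum_k v ord0 k ^+ 2).

Definition bdry (A : set 'rV[R]_d) : set 'rV[R]_d := closure A `\` interior A.

Definition bounded_domain (Omega : set 'rV[R]_d) : Prop :=
  [/\ Omega !=set0, open Omega, connected Omega & bounded_set Omega].

End geometry.

(* Simplicial : triangles (d = 2), tetrahedra (d = 3), with P1 elements;
   Cubical : quadrilaterals (d = 2), hexahedra (d = 3), with Q1 elements. *)
Inductive cell_kind := Simplicial | Cubical.

(* Vertices of the reference cell.  For the simplex, None is the origin and
   Some k is the k-th unit vector; a vertex of the cube [0,1]^d is given by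
   its 0/1 coordinates. *)
Definition lnode (c : cell_kind) (d : nat) : finType :=
  match c with
  | Simplicial => option 'I_d
  | Cubical => {ffun 'I_d -> bool}
  end.

Definition shape (R : realType) (c : cell_kind) (d : nat) :
    lnode c d -> 'rV[R]_d -> R :=
  match c with
  | Simplicial => fun (a : option 'I_d) xi =>
      if a is Some k then xi ord0 k else 1 - \sum_k xi ord0 k
  | Cubical => fun (a : {ffun 'I_d -> bool}) xi =>
      \prod_k (if a k then xi ord0 k else 1 - xi ord0 k)
  end.

Definition refcell (R : realType) (c : cell_kind) (d : nat) : set 'rV[R]_d :=
  match c with
  | Simplicial =>
      [set xi | (forall k, 0 <= xi ord0 k) /\ \sum_k xi ord0 k <= 1]
  | Cubical => [set xi | forall k, 0 <= xi ord0 k <= 1]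
  end.

Arguments refcell : clear implicits.

(* Vertex sets of the faces (of all dimensions, the empty face included) of
   the reference cell: every set of vertices for the simplex, the vertices
   with some prescribed coordinates for the cube. *)
Definition is_face (c : cell_kind) (d : nat) : {set lnode c d} -> Prop :=
  match c with
  | Simplicial => fun _ => True
  | Cubical => fun A : {set {ffun 'I_d -> bool}} =>
      A = finset.set0 \/ exists p : 'I_d -> option bool, forall a,
        (a \in A) = [forall k, if p k is Some b then a k == b else true]
  end.

(* Points of the face with vertex set A: those where the shape functions of
   all the other vertices vanish. *)
Definition face (R : realType) (c : cell_kind) (d : nat)
    (A : {set lnode c d}) : set 'rV[R]_d :=
  refcell R c d `&` [set xi | forall a, a \notin A -> shape a xi = 0].

Arguments face R {c d} A _.

Record mesh (R : realType) (d : nat) (c : cell_kind) := Mesh {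
  node : finType;
  elt : finType;
  pos : node -> 'rV[R]_d;
  vtx : elt -> lnode c d -> node
}.

Section mesh.
Context (R : realType) (d : nat) (c : cell_kind) (Th : mesh R d c).

(* Affine for simplices, multilinear for quadrilaterals and hexahedra. *)
Definition cellmap (e : elt Th) (xi : 'rV[R]_d) : 'rV[R]_d :=
  \sum_a shape a xi *: pos (vtx e a).

Definition cell (e : elt Th) : set 'rV[R]_d := cellmap e @` refcell R c d.

Definition nondegenerate_cell (e : elt Th) : Prop :=
  [/\ injective (vtx e),
      set_inj (refcell R c d) (cellmap e)
    & forall xi, refcell R c d xi -> \det ('J (cellmap e) xi) != 0].

Definition meet_in_common_face (e e' : elt Th) : Prop :=
  exists A A' : {set lnode c d},
    [/\ [/\ is_face A, is_face A' & A \proper [set: lnode c d]%SET],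
        [set vtx e a | a in A]%SET = [set vtx e' a | a in A']%SET,
        cell e `&` cell e' = cellmap e @` face R A
      & cell e `&` cell e' = cellmap e' @` face R A'].

Definition conforming_mesh (Omega : set 'rV[R]_d) : Prop :=
  [/\ injective (@pos R d c Th),
      forall i : node Th, exists e a, vtx e a = i,
      forall e, nondegenerate_cell e,
      closure Omega = \bigcup_(e in [set: elt Th]) cell e
    & forall e e', e != e' -> meet_in_common_face e e'].

Definition patch (i : node Th) : set 'rV[R]_d :=
  \bigcup_(e in [set e | exists a, vtx e a = i]) cell e.

Definition nbrs (i : node Th) : {set node Th} :=
  [set j | `[< patch i (pos j) >]]%SET.

(* xsym i j is a choice of the symmetric point x_ij^sym.  The intersection
   may offer several such points (non-convex patches, nodes on the boundary
   of Omega); any of them is allowed.  It may be pos i itself when node i is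
   on the boundary; the corresponding quotients are then 0 / 0 = 0. *)
Definition symmetric_points (xsym : node Th -> node Th -> 'rV[R]_d) : Prop :=
  forall i j, j \in (nbrs i :\ i)%SET ->
    [/\ exists s : R, xsym i j = pos i + s *: (pos j - pos i),
        bdry (patch i) (xsym i j)
      & xsym i j != pos j].

(* V_h; the span of the shape functions is P1, resp. Q1, on the reference
   cell.  Only the values on the closure of Omega matter. *)
Definition fe_space (Omega : set 'rV[R]_d) (v : 'rV[R]_d -> R) : Prop :=
  {within closure Omega, continuous v} /\
  forall e : elt Th, exists coef : lnode c d -> R,
    forall xi, refcell R c d xi ->
      v (cellmap e xi) = \sum_a coef a * shape a xi.

Definition nodal_basis (Omega : set 'rV[R]_d)
    (phi : node Th -> 'rV[R]_d -> R) : Prop :=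
  (forall i, fe_space Omega (phi i)) /\
  (forall i j, phi i (pos j) = (i == j)%:R).

(* Elementwise gradient; its value on the element boundaries (a null set) is
   irrelevant and set to 0. *)
Definition grad (v : 'rV[R]_d -> R) (x : 'rV[R]_d) : 'rV[R]_d :=
  if `[< exists e : elt Th, interior (cell e) x >]
  then \row_k 'D_(delta_mx ord0 k) v x else 0.

End mesh.

(* f' for a Lipschitz flux f: a bounded Borel representative of the a.e.
   defined derivative. *)
Definition flux_derivative (R : realType) (d : nat)
    (f df : R -> 'rV[R]_d) : Prop :=
  [/\ forall k, measurable_fun [set: R] (fun s => df s ord0 k),
      exists C, forall s, `|df s| <= C
    & {ae @lebesgue_measure R, forall s, is_derive s (1 : R) f (df s)}].

Section scheme.
Context (R : realType) (d : nat) (c : cell_kind) (Th : mesh R d c).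
Context (Omega : set 'rV[R]_d) (phi : node Th -> 'rV[R]_d -> R).
Context (df : R -> 'rV[R]_d) (xsym : node Th -> node Th -> 'rV[R]_d) (q : R).

(* w : node Th -> R is the vector of nodal values of w_h. *)
Implicit Types (w : node Th -> R) (i j : node Th).

Definition fe_fun w (x : 'rV[R]_d) : R := \sum_i w i * phi i x.

Definition l2 (v1 v2 : 'rV[R]_d -> R) : R :=
  integral_on Omega (fun x => v1 x * v2 x).

Definition Fmat w i j : R :=
  l2 (fun x => \sum_k df (fe_fun w x) ord0 k * grad Th (phi j) x ord0 k)
     (phi i).

Definition rdist i j : R := enorm (pos j - pos i).
Definition rdist_sym i j : R := enorm (xsym i j - pos i).
Definition usym w i j : R := fe_fun w (xsym i j).

Definition Jdet w i j : R :=
  (w j - w i) / rdist i j + (usym w i j - w i) / rdist_sym i j.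

Definition Adet w i j : R :=
  2^-1 * (`|w j - w i| / rdist i j + `|usym w i j - w i| / rdist_sym i j).

Definition alpha w i : R :=
  if \sum_(j in (nbrs i :\ i)%SET) Adet w i j != 0 then
    (`|\sum_(j in (nbrs i :\ i)%SET) Jdet w i j| /
      \sum_(j in (nbrs i :\ i)%SET) 2 * Adet w i j) `^ q
  else 0.

Definition nu_off w i j : R :=
  Num.max (Num.max (alpha w i * Fmat w i j) (alpha w j * Fmat w j i)) 0.

Definition nu w i j : R :=
  if i == j then \sum_(k in (nbrs i :\ i)%SET) nu_off w i k
  else nu_off w i j.

Definition Bmat w i j : R :=
  if j \in nbrs i then nu w i j * (2 * (i == j)%:R - 1) else 0.

Definition Kmat w i j : R := Fmat w i j + Bmat w i j.

Definition Mmat w i j : R :=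
  (1 - alpha w i) * l2 (phi j) (phi i) +
  alpha w i * l2 (fun=> (i == j)%:R) (phi i).

(* v is the vector of (continuous or discrete) time derivatives of w. *)
Definition scheme_eq (g : 'rV[R]_d -> R) w (v : node Th -> R) : Prop :=
  forall i, \sum_(j in nbrs i) Mmat w i j * v j +
            \sum_(j in nbrs i) Kmat w i j * w j = l2 g (phi i).

(* du t i is the derivative of t |-> u t i, one-sided at the final time. *)
Definition semidiscrete_solution (T : R) (g : R -> 'rV[R]_d -> R)
    (u du : R -> node Th -> R) : Prop :=
  forall t, 0 < t <= T ->
    (forall i, (u s i - u t i) / (s - t)
                 @[s --> within [set s | 0 <= s <= T] t^'] --> du t i) /\
    scheme_eq (g t) (u t) (du t).

Definition time_partition (T : R) (N : nat) (t : nat -> R) : Prop :=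
  [/\ t 0%N = 0, t N = T & forall n, (n < N)%N -> t n < t n.+1].

Definition delta_t (t : nat -> R) (u : nat -> node Th -> R) (n : nat) i : R :=
  (u n.+1 i - u n i) / (t n.+1 - t n).

Definition discrete_solution (N : nat) (t : nat -> R)
    (g : R -> 'rV[R]_d -> R) (u : nat -> node Th -> R) : Prop :=
  forall n, (n < N)%N ->
    scheme_eq (g (t n.+1)) (u n.+1) (delta_t t u n).

Definition is_maximum w i : Prop := forall j, j \in nbrs i -> w j <= w i.
Definition is_minimum w i : Prop := forall j, j \in nbrs i -> w i <= w j.

Definition LED_at w (v : node Th -> R) i : Prop :=
  (is_maximum w i -> v i <= 0) /\ (is_minimum w i -> 0 <= v i).

End scheme.

(* Main.v *)
Require Import Defs.
From mathcomp Require Import all_boot all_order all_algebra.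
From mathcomp Require Import all_classical all_reals all_analysis.
From mathcomp Require Import measurable_realfun.
From mathcomp Require Import ring lra.

(** At a node i where u_h is extremal on the patch, every difference entering
    the shock detector has the same sign, because u_h at the symmetric point
    is a convex combination of nodal values of the patch
    ([fe_fun_patch_le], [fe_fun_patch_ge]).  Hence |sum J| = sum 2A, and
    when this sum is nonzero alpha_i = 1 ^ q = 1 ([alpha_maximum],
    [alpha_minimum]).

    With alpha_i = 1, row i of the mass matrix is lumped to the number
    m_i = int phi_i, which is positive ([lumped_mass_gt0]), and nu_ij >= F_ij.
    The rows of F sum to zero, since the phi_j with j in the patch add up to 1
    there ([sum_Fmat]).  So the equation at node i reads
    m_i v_i = sum_(j <> i) (nu_ij - F_ij) (u_j - u_i)   ([nodal_balance]),
    v_i being the (continuous or discrete) time derivative of u_i.  The weights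
    nu_ij - F_ij are nonnegative, and the sign of v_i follows.

    The delicate point is the row sum: interchanging the sum with the integral
    needs each integrand to be integrable, that is, the gradients of the basis
    functions to be measurable and bounded.  On a Q1 cell the basis function
    is v o G, with v a polynomial and G the inverse of the multilinear cell
    map F, so this is a statement about the derivative of an inverse map.  It is
    obtained from slopes: a polynomial satisfies
    v eta - v xi = (eta - xi) a(eta, xi) with a jointly continuous, and likewise
    F eta - F xi = (eta - xi) A(eta, xi) with A(xi, xi) the Jacobian matrix.
    Solving for eta - xi expresses the difference quotients of v o G by a
    continuous function of G, so that the gradient is a continuous function of
    G ([is_derive_inverse_chain]), and G is continuous because the reference
    cell is compact ([cell_inverse_continuous]).  The gradient is therefore
    continuous inside each cell, and bounded by compactness
    ([derivative_on_cell]). *)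

Set Implicit Arguments.
Unset Strict Implicit.
Unset Printing Implicit Defensive.

Import Order.TTheory GRing.Theory Num.Theory.
Import numFieldNormedType.Exports.

Local Open Scope classical_set_scope.
Local Open Scope ring_scope.

(** * Lebesgue measure of boxes and measurability of open sets *)

Section boxes.
Context (R : realType).

Definition tbox n (I : 'I_n -> set R) : set (n.-tuple R) :=
  [set t | forall k, I k (tnth t k)].

Lemma measurable_tbox n (I : 'I_n -> set R) :
  (forall k, measurable (I k)) -> measurable (tbox I).
Proof.
move=> mI.
have -> : tbox I = \bigcap_(k in [set: 'I_n]) ((fun t => tnth t k) @^-1` I k).
  by apply/seteqP; split=> t /= It k; [move=> _; exact: It|exact: It].
apply: fin_bigcap_measurable => [|k _]; first exact: finite_finset.
by rewrite -[X in measurable X]setTI; apply: measurable_tnth.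
Qed.

(** The first coordinate of a tuple carries the last factor of the iterated
    product measure, so the induction peels off index 0. *)
Lemma leb_tbox n (I : 'I_n -> set R) : (forall k, measurable (I k)) ->
  leb R n (tbox I) = (\prod_(k < n) lebesgue_measure (I k))%E.
Proof.
elim: n I => [|n IH] I mI.
  by rewrite big_ord0 /= diracE mem_set// => -[].
rewrite big_ord_recl muleC /=.
have -> : leb_step (leb R n) (tbox I) = ((leb R n) \x (@lebesgue_measure R))%E
   (tbox (fun k => I (lift ord0 k)) `*` I ord0).
  rewrite /leb_step /pushforward; congr (_ _).
  apply/seteqP; split => -[p x]/=.
    move=> Ipx; split => /=; last by have := Ipx ord0; rewrite tnth0.
    by move=> k; have := Ipx (lift ord0 k); rewrite tnthS.
  move=> [Ip Ix] k; have [j ->|->] := unliftP ord0 k; last by rewrite tnth0.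
  by rewrite tnthS; exact: Ip.
rewrite product_measure1E//; last exact: mI.
  by rewrite IH.
by apply: (measurable_tbox (I := fun k => I (lift ord0 k))) => k; exact: mI.
Qed.

Context (d : nat).
Local Notation X := 'rV[R]_d.
Local Notation pot := (@point_of_tuple R d).

Lemma preimage_ball (x : X) (r : R) : 0 < r ->
  pot @^-1` ball x r = tbox (fun k => ball (x ord0 k) r).
Proof.
move=> r0; apply/seteqP; split=> t /=.
  by move=> [_ H] k; have := H ord0 k; rewrite /point_of_tuple mxE.
by move=> H; split => // i k; rewrite (ord1 i) /point_of_tuple mxE; exact: H.
Qed.

Lemma measurable_preimage_ball (x : X) (r : R) : 0 < r ->
  measurable (pot @^-1` ball x r).
Proof.
move=> r0; rewrite preimage_ball//; apply: measurable_tbox => k.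
by rewrite ball_itv; exact: measurable_itv.
Qed.

(** The sigma-algebra on tuples is generated by the coordinates; an open set
    belongs to it because it is a countable union of balls of the sup norm,
    which are boxes, with rational centre and radius. *)
Lemma measurable_preimage_open (U : set X) : open U ->
  measurable (pot @^-1` U).
Proof.
move=> oU.
pose B (c : 'rV[rat]_d * rat) := ball (map_mx (ratr : rat -> R) c.1) (ratr c.2).
pose F c := if `[< 0 < ratr c.2 :> R /\ B c `<=` U >] then pot @^-1` B c else set0.
have -> : pot @^-1` U = \bigcup_c F c.
  apply/seteqP; split=> t /=; last first.
    by move=> [c _]; rewrite /F; case: asboolP => // -[_ BU]; exact: BU.
  move=> Ut; have /nbhs_ballP[e /= e0 eU] := open_nbhs_nbhs (conj oU Ut).
  have /rat_in_itvoo[r] : 0 < e / 2 :> R by lra.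
  rewrite in_itv/= => /andP[r0 re].
  have Hq k : exists q : rat, ball (ratr q : R) (ratr r) (tnth t k).
    have /rat_in_itvoo[q] : tnth t k - ratr r < tnth t k + ratr r by lra.
    rewrite in_itv/= => /andP[q1 q2]; exists q.
    by rewrite ball_itv/= in_itv/=; apply/andP; split; lra.
  have [q Hq'] := choice Hq.
  have Bt : B (\row_k q k, r) (pot t).
    by split => // i k; rewrite /point_of_tuple !mxE.
  exists (\row_k q k, r) => //; rewrite /F; case: asboolP => // -[]; split => //=.
  move=> y By; apply: eU; apply: (@le_ball _ _ _ (ratr r + ratr r)); first by lra.
  exact: ball_triangle (ball_sym Bt) By.
apply: countable_bigcupT_measurable => [|c]; first exact: countableP.
rewrite /F; case: asboolP => // -[c0 _]; exact: measurable_preimage_ball.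
Qed.

Lemma measurable_fun_continuous_open (U : set X) (f : X -> R) : open U ->
  {in U, continuous f} -> measurable_fun (pot @^-1` U) (f \o pot).
Proof.
move=> oU cf mU; apply: (measurability _ (RGenOpens.measurableE R)) => //.
move=> _ [_ [a [b ->] <-]].
rewrite [X in measurable X](_ : _ = pot @^-1` (U `&` f @^-1` `]a, b[)); last by [].
apply: measurable_preimage_open; rewrite openE => x [Ux Vfx].
apply: filterI; first exact: (open_nbhs_nbhs (conj oU Ux)).
apply: (cf x (mem_set Ux)); apply: open_nbhs_nbhs.
by split; [exact: interval_open|exact: Vfx].
Qed.

Lemma leb_ball (x : X) (r : R) : 0 < r ->
  (0 < leb R d (pot @^-1` ball x r) < +oo)%E.
Proof.
move=> r0; rewrite preimage_ball// leb_tbox; last first.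
  by move=> k; rewrite ball_itv; exact: measurable_itv.
elim/big_ind: _ => [|y z /andP[y0 yoo] /andP[z0 zoo]|k _].
- by rewrite lte01 ltry.
- by rewrite mule_gt0//= lte_mul_pinfty// ?ltW// ge0_fin_numE// ltW.
- by rewrite ball_itv lebesgue_measure_itv/= lte_fin; case: ifPn => [_|];
   rewrite ?lte_fin ?ltry; lra.
Qed.

End boxes.

(** * Slopes of polynomial maps and the derivative of an inverse map *)

Section entrywise_convergence.
Context (R : realType) (T : Type) (F : set_system T) {FF : Filter F}.

Lemma cvg_bigsum (I : Type) (r : seq I) (P : pred I) (f : I -> T -> R)
    (l : I -> R) : (forall i, P i -> f i x @[x --> F] --> l i) ->
  \sum_(i <- r | P i) f i x @[x --> F] --> \sum_(i <- r | P i) l i.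
Proof.
move=> fl; apply: cvg_big => // p; apply: cvgD; [exact: cvg_fst|exact: cvg_snd].
Qed.

Lemma cvg_bigprod (I : Type) (r : seq I) (P : pred I) (f : I -> T -> R)
    (l : I -> R) : (forall i, P i -> f i x @[x --> F] --> l i) ->
  \prod_(i <- r | P i) f i x @[x --> F] --> \prod_(i <- r | P i) l i.
Proof.
move=> fl; apply: cvg_big => // p; apply: cvgM; [exact: cvg_fst|exact: cvg_snd].
Qed.

(** Entrywise, so that products, determinants and adjugates reduce to limits of
    sums and products of scalars. *)
Definition mxcvg m n (M : T -> 'M[R]_(m, n)) (N : 'M[R]_(m, n)) :=
  forall i j, M x i j @[x --> F] --> N i j.

Lemma mxcvg_cst m n (N : 'M[R]_(m, n)) : mxcvg (fun=> N) N.
Proof. by move=> i j; exact: cvg_cst. Qed.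

Lemma mxcvgM m n p (M : T -> 'M[R]_(m, n)) N (M' : T -> 'M[R]_(n, p)) N' :
  mxcvg M N -> mxcvg M' N' -> mxcvg (fun x => M x *m M' x) (N *m N').
Proof.
move=> MN MN' i j; rewrite mxE; under eq_fun do rewrite mxE.
by apply: cvg_bigsum => k _; exact: cvgM.
Qed.

Lemma cvg_det n (M : T -> 'M[R]_n) N : mxcvg M N ->
  \det (M x) @[x --> F] --> \det N.
Proof.
move=> MN; apply: cvg_bigsum => s _; apply: cvgM; first exact: cvg_cst.
by apply: cvg_bigprod => i _; exact: MN.
Qed.

Lemma mxcvg_adj n (M : T -> 'M[R]_n) N : mxcvg M N ->
  mxcvg (fun x => \adj (M x)) (\adj N).
Proof.
move=> MN i j; rewrite mxE; under eq_fun do rewrite mxE.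
apply: cvgM; first exact: cvg_cst.
apply: cvg_det => k l; rewrite !mxE; under eq_fun do rewrite !mxE.
exact: MN.
Qed.

End entrywise_convergence.

Section slopes.
Context (R : realType) (d : nat).
Local Notation X := 'rV[R]_d.

(** A Hadamard factorization of the increments of f, with a jointly continuous
    factor; a (x, x) is then the gradient of f at x. *)
Definition slope (f : X -> R) (a : X * X -> 'cV[R]_d) : Prop :=
  (forall p, mxcvg (nbhs p) a (a p)) /\
  forall y x, f y - f x = ((y - x) *m a (y, x)) ord0 ord0.

(** The slope gives the increments exactly, with no remainder term; plain
    differentiability is kept alongside because the Jacobian matrix is defined
    from the differential. *)
Definition smooth (f : X -> R) : Prop :=
  (forall x, differentiable f x) /\ exists a, slope f a.

Lemma smooth_cst c : smooth (fun=> c).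
Proof.
split; first by move=> x; exact: differentiable_cst.
exists (fun=> 0); split; first by move=> p; exact: mxcvg_cst.
by move=> y x; rewrite subrr mulmx0 mxE.
Qed.

Lemma smooth_coord k : smooth (fun x => x ord0 k).
Proof.
split; first by move=> x; exact: differentiable_coord.
exists (fun=> delta_mx k ord0); split; first by move=> p; exact: mxcvg_cst.
by move=> y x; rewrite -colE !mxE.
Qed.

Lemma smoothD f g : smooth f -> smooth g -> smooth (fun x => f x + g x).
Proof.
move=> [df [a [ca fa]]] [dg [b [cb gb]]]; split.
  by move=> x; apply: differentiableD.
exists (fun p => a p + b p); split.
  move=> p i j; rewrite mxE; under eq_fun do rewrite mxE.
  by apply: cvgD; [exact: ca|exact: cb].
by move=> y x; rewrite mulmxDr mxE -fa -gb; ring.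
Qed.

Lemma smoothM f g : smooth f -> smooth g -> smooth (fun x => f x * g x).
Proof.
move=> [df [a [ca fa]]] [dg [b [cb gb]]]; split.
  by move=> x; apply: differentiableM.
exists (fun p => f p.1 *: b p + g p.2 *: a p); split.
  move=> p i j; rewrite !mxE; under eq_fun do rewrite !mxE.
  apply: cvgD; apply: cvgM; [|exact: cb| |exact: ca].
    apply: (@cvg_comp _ _ _ fst f _ (nbhs p.1)); first exact: cvg_fst.
    exact: (differentiable_continuous (df p.1)).
  apply: (@cvg_comp _ _ _ snd g _ (nbhs p.2)); first exact: cvg_snd.
  exact: (differentiable_continuous (dg p.2)).
move=> y x; transitivity (f y * ((y - x) *m b (y, x)) ord0 ord0 +
    g x * ((y - x) *m a (y, x)) ord0 ord0); first by rewrite -fa -gb; ring.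
by rewrite mulmxDr -!scalemxAr !mxE.
Qed.

Lemma smoothB f g : smooth f -> smooth g -> smooth (fun x => f x - g x).
Proof.
move=> sf sg; rewrite (_ : (fun _ => _) = (fun x => f x + (- 1) * g x)).
  by apply: smoothD => //; apply: smoothM => //; exact: smooth_cst.
by apply/funext => x; rewrite mulN1r.
Qed.

Lemma smooth_sum (I : Type) (r : seq I) (F : I -> X -> R) :
  (forall i, smooth (F i)) -> smooth (fun x => \sum_(i <- r) F i x).
Proof.
move=> sF; elim: r => [|i r IH].
  by under eq_fun do rewrite big_nil; exact: smooth_cst.
by under eq_fun do rewrite big_cons; exact: smoothD.
Qed.

Lemma smooth_prod (I : Type) (r : seq I) (F : I -> X -> R) :
  (forall i, smooth (F i)) -> smooth (fun x => \prod_(i <- r) F i x).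
Proof.
move=> sF; elim: r => [|i r IH].
  by under eq_fun do rewrite big_nil; exact: smooth_cst.
by under eq_fun do rewrite big_cons; exact: smoothM.
Qed.

Lemma smooth_continuous f : smooth f -> continuous f.
Proof. by move=> [df _] x; exact: differentiable_continuous. Qed.

Lemma smooth_shape (c : cell_kind) (a : lnode c d) : smooth (@Defs.shape R c d a).
Proof.
case: c a => [[k|]|a] /=; first exact: smooth_coord.
  apply: smoothB; first exact: smooth_cst.
  by apply: smooth_sum => k; exact: smooth_coord.
apply: smooth_prod => k; case: (a k); first exact: smooth_coord.
by apply: smoothB; [exact: smooth_cst|exact: smooth_coord].
Qed.

Definition slopemx (F : X -> X) (A : X * X -> 'M[R]_d) : Prop :=
  (forall p, mxcvg (nbhs p) A (A p)) /\
  forall y x, F y - F x = (y - x) *m A (y, x).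

Lemma cvg_pair_nbhs (T : Type) (F : set_system T) (FF : Filter F)
    (U V : topologicalType) (f : T -> U) (g : T -> V) (u : U) (v : V) :
  f @ F --> u -> g @ F --> v -> (f t, g t) @[t --> F] --> (u, v).
Proof. by move=> fu gv; apply: (@cvg_pair _ _ _ F (nbhs u) (nbhs v)). Qed.

Lemma cvg_line (x w : X) : h *: w + x @[h --> (0 : R)^'] --> x.
Proof.
have L : h *: w @[h --> (0 : R)^'] --> 0 *: w.
  by apply: cvgZr_tmp; exact: cvg_within.
have H := cvgD L (cvg_cst x (F := (0 : R)^')); rewrite scale0r add0r in H.
exact: H.
Qed.

(** This turns the nondegeneracy hypothesis on cells, which speaks of the
    Jacobian, into invertibility of the slope on the diagonal, hence near it. *)
Lemma slopemx_jacobian F A x : slopemx F A -> differentiable F x ->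
  'J F x = A (x, x).
Proof.
move=> [cA FA] dF; apply/row_matrixP => k; rewrite !rowE -deriveEjacobian//.
set w := delta_mx _ _; apply/rowP => j.
have L : (h^-1 *: (F (h *: w + x) - F x)) ord0 j @[h --> (0 : R)^'] -->
    ('D_w F x) ord0 j.
  apply: (@cvg_comp _ _ _ (fun h => h^-1 *: (F (h *: w + x) - F x))
    (fun M : X => M ord0 j) _ (nbhs ('D_w F x))); last exact: coord_continuous.
  have dw : derivable F x w by exact: diff_derivable.
  exact: dw.
rewrite -(cvg_lim _ L)//; apply/cvg_lim => //.
have G : (h *: w + x, x) @[h --> (0 : R)^'] --> (x, x).
  by apply: cvg_pair_nbhs; [exact: cvg_line|exact: cvg_cst].
have W : (w *m A (h *: w + x, x)) ord0 j @[h --> (0 : R)^'] -->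
    (w *m A (x, x)) ord0 j.
  apply: (cvg_comp _ (fun p => (w *m A p) ord0 j) G).
  by apply: mxcvgM; [exact: mxcvg_cst|exact: cA].
apply: cvg_trans W; apply: near_eq_cvg; near=> h.
have h0 : h != 0 by near: h; exact: nbhs_dnbhs_neq.
by rewrite FA addrK -scalemxAl scalerA mulVf// scale1r.
Unshelve. all: by end_near.
Qed.

(** The entry of w A^-1 a, with the inverse written by Cramer's rule so that
    continuity follows from that of the determinant and the adjugate. *)
Definition chain_slope (A : X * X -> 'M[R]_d) (a : X * X -> 'cV[R]_d) (w : X)
    (p : X * X) : R :=
  (\det (A p))^-1 * (w *m \adj (A p) *m a p) ord0 ord0.

Lemma cvg_chain_slope (T : Type) (F : set_system T) (FF : Filter F)
    (A : X * X -> 'M[R]_d) (a : X * X -> 'cV[R]_d) (w : X)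
    (g : T -> X * X) (p : X * X) :
  (forall p, mxcvg (nbhs p) A (A p)) -> (forall p, mxcvg (nbhs p) a (a p)) ->
  \det (A p) != 0 -> g @ F --> p ->
  chain_slope A a w (g t) @[t --> F] --> chain_slope A a w p.
Proof.
move=> cA ca Ap gp; apply: (cvg_comp _ (chain_slope A a w) gp); apply: cvgM.
  by apply: cvgV => //; exact: cvg_det.
apply: mxcvgM; last exact: ca.
by apply: mxcvgM; [exact: mxcvg_cst|exact: mxcvg_adj].
Qed.

(** With eta = G (x + h w) and xi = G x, one has
    h w = (eta - xi) A (eta, xi) and
    phi (x + h w) - phi x = (eta - xi) a (eta, xi); eliminating eta - xi leaves
    the difference quotient equal to [chain_slope] at (eta, xi), and eta tends
    to xi.  The argument uses the continuity of G at x but no neighbourhood of G x in the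
    range of G, so that G x may lie on the boundary of the reference cell. *)
Lemma is_derive_inverse_chain F A v a (phi : X -> R) (G : X -> X) x w :
  slopemx F A -> slope v a ->
  (\forall y \near x, F (G y) = y /\ phi y = v (G y)) ->
  {for x, continuous G} -> \det (A (G x, G x)) != 0 ->
  is_derive x w phi (chain_slope A a w (G x, G x)).
Proof.
move=> [cA FA] [ca va] nearx Gx detA.
suff H : (h^-1 *: ((phi \o shift x) (h *: w) - phi x)) @[h --> 0^'] -->
    chain_slope A a w (G x, G x).
  by apply: DeriveDef; [apply/cvg_ex; eexists; exact: H|exact/cvg_lim].
have Gl : (G (h *: w + x), G x) @[h --> (0 : R)^'] --> (G x, G x).
  apply: cvg_pair_nbhs; last exact: cvg_cst.
  apply: (@cvg_comp _ _ _ (fun h => h *: w + x) G _ (nbhs x)) => //; exact: cvg_line.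
apply: cvg_trans (cvg_chain_slope (w := w) _ cA ca detA Gl).
apply: near_eq_cvg.
have [FGx phix] := nbhs_singleton nearx.
have dl : \det (A (G (h *: w + x), G x)) @[h --> (0 : R)^'] -->
    \det (A (G x, G x)).
  by apply: (cvg_comp _ (fun p => \det (A p)) Gl); exact: cvg_det.
have dn0 : \forall h \near (0 : R)^', \det (A (G (h *: w + x), G x)) != 0.
  exact: cvgr_neq0 dl detA.
have nearl : \forall h \near (0 : R)^', F (G (h *: w + x)) = h *: w + x /\
    phi (h *: w + x) = v (G (h *: w + x)) by exact: cvg_line nearx.
have hn0 : \forall h \near (0 : R)^', h != 0 by exact: nbhs_dnbhs_neq.
near=> h.
have h0 : h != 0 by near: h.
have dh : \det (A (G (h *: w + x), G x)) != 0 by near: h.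
have [Fh ph] : F (G (h *: w + x)) = h *: w + x /\
    phi (h *: w + x) = v (G (h *: w + x)) by near: h.
rewrite /chain_slope /= ph phix va.
set p := (_, _) in dh *.
have wE : h *: (w *m \adj (A p)) = \det (A p) *: (G (h *: w + x) - G x).
  have hw : h *: w = (G (h *: w + x) - G x) *m A p by rewrite -FA Fh FGx addrK.
  by rewrite scalemxAl [X in X *m _]hw -mulmxA mul_mx_adj mul_mx_scalar.
have -> : w *m \adj (A p) = h^-1 *: (\det (A p) *: (G (h *: w + x) - G x)).
  by rewrite -wE scalerA mulVf// scale1r.
rewrite -!scalemxAl; set m := (_ - _) *m _; rewrite !mxE mulrCA mulKf//.
Unshelve. all: by end_near.
Qed.

End slopes.

(** * The reference cell *)

Lemma sum_option (R : realType) (T : finType) (F : option T -> R) :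
  \sum_a F a = F None + \sum_t F (Some t).
Proof.
rewrite (bigD1 None)//=; congr (_ + _).
rewrite (reindex_omap Some id)/=; last by case.
by apply: eq_bigl => t; rewrite eqxx.
Qed.

Section reference_cell.
Context (R : realType) (d : nat) (c : cell_kind).
Local Notation X := 'rV[R]_d.
Local Notation shape := (@Defs.shape R c d).
Local Notation K := (refcell R c d).

Lemma shape_ge0 (a : lnode c d) (xi : X) : K xi -> 0 <= shape a xi.
Proof.
case: c a => [[k|] [xi0 xi1]|a xi01] //=; first by rewrite subr_ge0.
by apply: prodr_ge0 => k _; have /andP[] := xi01 k; case: (a k) => //; lra.
Qed.

Lemma sum_shape (xi : X) : \sum_(a : lnode c d) shape a xi = 1.
Proof.
case: c => /=.
  by rewrite sum_option/= subrK.
rewrite -(bigA_distr_bigA (fun (k : 'I_d) (b : bool) =>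
  if b then xi ord0 k else 1 - xi ord0 k)).
by apply: big1 => k _; rewrite big_bool/=; ring.
Qed.

Definition refvertex : lnode c d -> X :=
  match c return lnode c d -> X with
  | Simplicial => fun a => if a is Some k then delta_mx ord0 k else 0
  | Cubical => fun a => \row_k (a k)%:R
  end.

Lemma refcell_refvertex a : K (refvertex a).
Proof.
rewrite /refvertex; case: c a => [[k|]|a] /=.
- split; first by move=> j; rewrite mxE ler0n.
  rewrite (bigD1 k)//= big1 ?addr0 ?mxE ?eqxx// => j jk.
  by rewrite mxE (negbTE jk) andbF.
- split; first by move=> j; rewrite mxE.
  by rewrite big1 ?ler01// => j _; rewrite mxE.
- by move=> k; rewrite mxE; case: (a k); rewrite ?lexx ?ler01.
Qed.

Lemma shape_refvertex a b : shape a (refvertex b) = (a == b)%:R.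
Proof.
rewrite /refvertex; case: c a b => [[k|] [l|]|a b] /=.
- by rewrite mxE eqxx.
- by rewrite mxE.
- rewrite (bigD1 l)//= big1 ?addr0 ?mxE ?eqxx ?subrr// => j jl.
  by rewrite mxE (negbTE jl) andbF.
- by rewrite big1 ?subr0// => j _; rewrite mxE.
- have [->|ab] := eqVneq a b.
    by apply: big1 => k _; rewrite mxE; case: (b k); rewrite ?subr0.
  have [k abk] : exists k, a k != b k.
    apply/existsP; rewrite -negb_forall; apply: contra ab => /forallP ab.
    by apply/eqP/ffunP => k; exact/eqP.
  apply/eqP/prodf_eq0; exists k => //; move: abk; rewrite mxE.
  by case: (a k); case: (b k) => //; rewrite subrr.
Qed.

Lemma compact_refcell : compact K.
Proof.
have clF (f : X -> R) (D : set R) : smooth f -> closed D -> closed (f @^-1` D).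
  by move=> sf cD; apply: closed_comp => // x _; exact: smooth_continuous.
apply: bounded_closed_compact; last first.
  case: c => /=.
    rewrite [X in closed X](_ : _ =
      (\bigcap_(k in [set: 'I_d]) ((fun xi : X => xi ord0 k) @^-1`
        [set t | 0 <= t])) `&`
      ((fun xi : X => \sum_k xi ord0 k) @^-1` [set t | t <= 1])); last first.
      by apply/seteqP; split => xi /= [H1 H2]; split => // k *; exact: H1.
    apply: closedI; last first.
      apply: clF; last exact: closed_le.
      by apply: smooth_sum => k; exact: smooth_coord.
    by apply: closed_bigI => k _; apply: clF; [exact: smooth_coord|exact: closed_ge].
  rewrite [X in closed X](_ : _ =
      \bigcap_(k in [set: 'I_d]) ((fun xi : X => xi ord0 k) @^-1`
        `[0, 1])); last first.
    apply/seteqP; split => xi /= H k; first by move=> _; rewrite /= in_itv/=.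
    by have := H k Logic.I; rewrite /= in_itv/=.
  by apply: closed_bigI => k _; apply: clF; [exact: smooth_coord|exact: interval_closed].
have K01 xi : K xi -> forall k, 0 <= xi ord0 k <= 1.
  case: c => //= -[xi0 xi1] k; rewrite xi0/=; apply: le_trans xi1.
  by rewrite (bigD1 k)//= lerDl sumr_ge0.
exists 1; split => // M M1 xi Kxi; apply: le_trans (ltW M1).
rewrite [leLHS]/Num.norm/= mx_normrE; apply/bigmax_leP; split => //= -[i k] _.
by rewrite (ord1 i)/= ler_norml; have /andP[? ?] := K01 xi Kxi k; lra.
Qed.

End reference_cell.

(** * Cells of a mesh *)

Section cells.
Context (R : realType) (d : nat) (c : cell_kind) (Th : mesh R d c).
Local Notation X := 'rV[R]_d.
Local Notation shape := (@Defs.shape R c d).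
Local Notation K := (refcell R c d).
Local Notation refvertex := (@refvertex R d c).
Implicit Types (e : elt Th) (i j : node Th).

Lemma differentiable_sumZ (I : Type) (r : seq I) (f : I -> X -> R) (p : I -> X) x :
  (forall l : I, differentiable (f l) x) ->
  differentiable (fun y => \sum_(l <- r) f l y *: p l) x.
Proof.
move=> df; elim: r => [|l r IH].
  by under eq_fun do rewrite big_nil; exact: differentiable_cst.
under eq_fun do rewrite big_cons; apply: differentiableD => //.
exact: differentiableZl.
Qed.

Lemma differentiable_cellmap e x : differentiable (cellmap e) x.
Proof. by apply: differentiable_sumZ => a; have [] := @smooth_shape R d c a. Qed.

Lemma slopemx_cellmap e : exists A, slopemx (cellmap e) A.
Proof.
have /choice[s sP] (a : lnode c d) : exists s, slope (shape a) s.
  by have [_] := @smooth_shape R d c a.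
exists (fun p => \sum_a s a p *m pos (vtx e a)); split.
  move=> p i j; rewrite summxE; under eq_fun do rewrite summxE.
  apply: cvg_bigsum => a _; have [cs _] := sP a.
  by apply: mxcvgM; [exact: cs|exact: mxcvg_cst].
move=> y x; rewrite /cellmap -sumrB mulmx_sumr; apply: eq_bigr => a _.
have [_ sE] := sP a; rewrite -scalerBl sE mulmxA -mul_scalar_mx.
congr (_ *m _); apply/matrixP => i j.
by rewrite (ord1 i) (ord1 j) [LHS]mxE eqxx mulr1n.
Qed.

Lemma continuous_cellmap e : continuous (cellmap e).
Proof.
by move=> x; apply: differentiable_continuous; exact: differentiable_cellmap.
Qed.

Lemma compact_cell_image e (C : set X) : compact C -> closed (cellmap e @` C).
Proof.
move=> cC; apply: compact_closed; first exact: norm_hausdorff.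
apply: continuous_compact => //; apply: continuous_subspaceT.
exact: continuous_cellmap.
Qed.

Lemma closed_cell e : closed (cell e).
Proof. by apply: compact_cell_image; exact: compact_refcell. Qed.

Lemma cellmap_refvertex e a : cellmap e (refvertex a) = pos (vtx e a).
Proof.
rewrite /cellmap (bigD1 a)//= shape_refvertex eqxx scale1r big1 ?addr0// => b ba.
by rewrite shape_refvertex (negbTE ba) scale0r.
Qed.

Lemma cell_vertex e a : cell e (pos (vtx e a)).
Proof.
by exists (refvertex a); [exact: refcell_refvertex|exact: cellmap_refvertex].
Qed.

Lemma vtx_nbrs e a b : vtx e b \in nbrs (vtx e a).
Proof.
rewrite inE; apply/asboolP; exists e; first by exists a.
exact: cell_vertex.
Qed.

Lemma closed_patch i : closed (Defs.patch i).
Proof.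
by apply: closed_bigcup => [|e _]; [exact: finite_finset|exact: closed_cell].
Qed.

(** If G left a neighbourhood of G x arbitrarily close to x, then x would be in
    the image of the rest of the reference cell, which is compact and hence has
    a closed image, contradicting injectivity. *)
Lemma cell_inverse_continuous e (G : X -> X) x :
  set_inj K (cellmap e) ->
  (forall y, cell e y -> K (G y) /\ cellmap e (G y) = y) ->
  (cell e)^° x -> {for x, continuous G}.
Proof.
move=> inje GP xint; have xe : cell e x by exact: interior_subset xint.
have [KGx FGx] := GP _ xe.
move=> V /nbhs_interior => nV.
pose C := K `&` ~` V^°.
have cC : compact C.
  apply: compact_closedI; first exact: compact_refcell.
  by rewrite closedC; exact: open_interior.
have FC : ~ (cellmap e @` C) x.
  move=> [xi [Kxi Vxi] Fxi]; apply: Vxi.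
  have -> : xi = G x by apply: inje; rewrite ?inE// Fxi FGx.
  exact: nbhs_singleton nV.
have oC : nbhs x (~` (cellmap e @` C)).
  by apply: open_nbhs_nbhs; split => //; rewrite openC; exact: compact_cell_image.
suff : \forall y \near x, V (G y) by [].
near=> y.
have ye : cell e y by apply: interior_subset; near: y; exact: nbhs_interior.
have yC : ~ (cellmap e @` C) y by near: y.
have [KGy FGy] := GP _ ye.
apply: contrapT => VGy; apply: yC; exists (G y) => //; split => // /interior_subset.
exact: VGy.
Unshelve. all: by end_near.
Qed.

(** D is a continuous function on the compact reference cell composed with the
    inverse of the cell map: this is where its bound comes from. *)
Lemma derivative_on_cell e (v phi : X -> R) (w : X) :
  nondegenerate_cell e -> smooth v ->
  (forall xi, K xi -> phi (cellmap e xi) = v xi) ->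
  exists D : X -> R,
    [/\ forall x, (cell e)^° x -> is_derive x w phi (D x),
        forall x, (cell e)^° x -> {for x, continuous D}
      & exists M, forall x, (cell e)^° x -> `|D x| <= M].
Proof.
move=> [_ inje detJ] [_ [a va]] phiE.
have [A FA] := slopemx_cellmap e.
have detA xi : K xi -> \det (A (xi, xi)) != 0.
  move=> Kxi; rewrite -(slopemx_jacobian FA); first exact: detJ.
  exact: differentiable_cellmap.
have /choice[G GP] (y : X) : exists xi, cell e y -> K xi /\ cellmap e xi = y.
  have [[xi Kxi <-]|ny] := pselect (cell e y); first by exists xi.
  by exists 0 => /ny.
have cG x : (cell e)^° x -> {for x, continuous G}.
  exact: cell_inverse_continuous.
pose Q xi := chain_slope A a w (xi, xi).
have cQ xi : K xi -> {for xi, continuous Q}.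
  move=> Kxi; have [cA _] := FA; have [ca _] := va.
  apply: (@cvg_chain_slope _ _ _ (nbhs xi) (nbhs_filter xi)) cA ca (detA _ Kxi) _.
  by apply: cvg_pair_nbhs; exact: cvg_id.
exists (Q \o G); split => [x xe|x xe|].
- have [KGx FGx] := GP x (interior_subset xe).
  apply: (@is_derive_inverse_chain R d (cellmap e) A v a) => //.
  + near=> y.
    have ye : cell e y by apply: interior_subset; near: y; exact: nbhs_interior.
    have [KGy FGy] := GP y ye; split => //.
    by rewrite -[in LHS]FGy phiE.
  + exact: cG.
  + exact: detA.
- have [KGx _] := GP x (interior_subset xe).
  by apply: continuous_comp; [exact: cG|exact: cQ].
- have : compact (Q @` K).
    apply: continuous_compact; last exact: compact_refcell.
    by apply: continuous_in_subspaceT => xi /set_mem; exact: cQ.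
  move=> /compact_bounded[M [_ MQ]]; exists (M + 1) => x /interior_subset xe.
  by have [KGx _] := GP x xe; apply: (MQ (M + 1)); [rewrite ltrDl|exists (G x)].
Unshelve. all: by end_near.
Qed.

End cells.

(** * Finite element functions *)

Section finite_elements.
Context (R : realType) (d : nat) (c : cell_kind) (Th : mesh R d c).
Local Notation X := 'rV[R]_d.
Local Notation shape := (@Defs.shape R c d).
Local Notation K := (refcell R c d).
Local Notation refvertex := (@refvertex R d c).
Local Notation patch := (@Defs.patch R d c Th).
Context (Omega : set X) (hTh : conforming_mesh Th Omega).
Implicit Types (e : elt Th) (i j : node Th).

(** The shape functions are dual to the reference vertices, which identifies
    the coefficients on a cell as values at its vertices. *)
Lemma fe_cell (v : X -> R) e xi : fe_space Th Omega v -> K xi ->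
  v (cellmap e xi) = \sum_a v (pos (vtx e a)) * shape a xi.
Proof.
move=> [_ /(_ e)[coef vE]] Kxi; rewrite vE//; apply: eq_bigr => a _.
rewrite -cellmap_refvertex vE; last exact: refcell_refvertex.
rewrite (bigD1 a)//= shape_refvertex eqxx mulr1 big1 ?addr0// => b ba.
by rewrite shape_refvertex (negbTE ba) mulr0.
Qed.

Lemma fe_space_continuous (v : X -> R) : open Omega ->
  fe_space Th Omega v -> {in Omega, continuous v}.
Proof.
move=> oO [cv _]; rewrite -continuous_open_subspace//.
exact: (continuous_subspaceW (@subset_closure _ Omega) cv).
Qed.

Lemma closure_cell x : closure Omega x -> exists e xi, K xi /\ cellmap e xi = x.
Proof.
have [_ _ _ -> _] := hTh => -[e _ [xi Kxi <-]]; by exists e, xi.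
Qed.

Lemma nodes_nbrs i : i \in nbrs i.
Proof. by have [_ /(_ i)[e [a <-]] _ _ _] := hTh; exact: vtx_nbrs. Qed.

Lemma nondegenerate e : nondegenerate_cell e.
Proof. by have [_ _ + _ _] := hTh; apply. Qed.

Lemma smooth_fe (v : X -> R) e : fe_space Th Omega v ->
  exists2 u : X -> R, smooth u & forall xi, K xi -> v (cellmap e xi) = u xi.
Proof.
move=> [_ /(_ e)[coef vE]]; exists (fun xi => \sum_a coef a * shape a xi) => //.
apply: smooth_sum => a; apply: smoothM; first exact: smooth_cst.
exact: smooth_shape.
Qed.

Lemma derivable_fe (v : X -> R) e x w : fe_space Th Omega v ->
  (cell e)^° x -> derivable v x w.
Proof.
move=> fv xe; have [u su vu] := smooth_fe e fv.
by have [D [+ _ _]] := derivative_on_cell w (nondegenerate e) su vu => /(_ x xe)[].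
Qed.

Lemma grad_interior (v : X -> R) e x k : (cell e)^° x ->
  grad Th v x ord0 k = 'D_(delta_mx ord0 k) v x.
Proof.
by move=> xe; rewrite /grad; case: asboolP => [_|[]]; [rewrite mxE|exists e].
Qed.

Lemma grad_exterior (v : X -> R) x k :
  ~ (exists e : elt Th, (cell e)^° x) -> grad Th v x ord0 k = 0.
Proof. by move=> xe; rewrite /grad; case: asboolP => // _; rewrite mxE. Qed.

(** The gradient is continuous on the open union of the cell interiors and 0
    elsewhere. *)
Lemma measurable_grad (v : X -> R) k : fe_space Th Omega v ->
  measurable_fun [set: d.-tuple R]
    (fun t => grad Th v (point_of_tuple t) ord0 k).
Proof.
move=> fv; pose U := \bigcup_(e in [set: elt Th]) (cell e)^°.
have oU : open U by apply: bigcup_open => e _; exact: open_interior.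
have mU := measurable_preimage_open oU.
rewrite -(setUv (@point_of_tuple R d @^-1` U)); apply/measurable_funU => //.
  exact: measurableC.
split.
  apply: (@measurable_fun_continuous_open R d U (fun x => grad Th v x ord0 k)) => //.
  move=> x /set_mem[e _ xe].
  have [u su vu] := smooth_fe e fv.
  have [D [gD cD _]] := derivative_on_cell (delta_mx ord0 k) (nondegenerate e) su vu.
  have gE y : (cell e)^° y -> grad Th v y ord0 k = D y.
    by move=> ye; rewrite (grad_interior v k ye); have [] := gD y ye.
  have nE : \forall y \near x, D y = grad Th v y ord0 k.
    apply: filterS (nbhs_interior xe) => y ye; rewrite gE//.
  rewrite /continuous_at gE//; apply: cvg_trans (cD x xe).
  exact: (@near_eq_cvg _ _ (nbhs x) _ _ _ nE).
apply: (eq_measurable_fun (cst (0 : R))) => [t|]; last exact: measurable_cst.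
rewrite inE => /= Ut; rewrite grad_exterior// => -[e te]; apply: Ut.
by exists e.
Qed.

Lemma bounded_grad (v : X -> R) k : fe_space Th Omega v ->
  exists M, forall x, `|grad Th v x ord0 k| <= M.
Proof.
move=> fv.
have /choice[M MP] e : exists M, forall x, (cell e)^° x -> `|grad Th v x ord0 k| <= M.
  have [u su vu] := smooth_fe e fv.
  have [D [gD _ [M DM]]] := derivative_on_cell (delta_mx ord0 k) (nondegenerate e) su vu.
  exists M => x xe; rewrite (grad_interior v k xe); have [_ ->] := gD x xe.
  exact: DM.
exists (\sum_e `|M e|) => x.
have [[e xe]|xe] := pselect (exists e : elt Th, (cell e)^° x); last first.
  by rewrite grad_exterior// normr0 sumr_ge0.
apply: le_trans (MP e x xe) _; apply: le_trans (ler_norm _) _.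
by rewrite (bigD1 e)//= lerDl sumr_ge0.
Qed.

Context (phi : node Th -> X -> R) (hphi : nodal_basis Omega phi).

(** For a vertex i of the cell this is its shape function; otherwise it is 0. *)
Lemma nodal_basis_cell i e xi : K xi ->
  phi i (cellmap e xi) = \sum_a (i == vtx e a)%:R * shape a xi.
Proof.
have [fphi dphi] := hphi; move=> Kxi; rewrite fe_cell//.
by apply: eq_bigr => a _; rewrite dphi.
Qed.

Lemma fe_fun_cell w e xi : K xi ->
  fe_fun phi w (cellmap e xi) = \sum_a w (vtx e a) * shape a xi.
Proof.
move=> Kxi; rewrite /fe_fun.
under eq_bigr do rewrite nodal_basis_cell// mulr_sumr.
rewrite exchange_big/=; apply: eq_bigr => a _.
rewrite (bigD1 (vtx e a))//= eqxx mul1r big1 ?addr0// => i /negbTE ->.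
by rewrite mul0r mulr0.
Qed.

(** On a cell of the patch, the shape functions are the weights of a convex
    combination of vertex values, and the vertices of the cell are
    neighbours of i. *)
Lemma fe_fun_patch_le w i M x : patch i x ->
  (forall j, j \in nbrs i -> w j <= M) -> fe_fun phi w x <= M.
Proof.
move=> [e [a ai] [xi Kxi <-]] wM; rewrite fe_fun_cell// -[M]mulr1.
rewrite -(sum_shape c xi) mulr_sumr; apply: ler_sum => b _.
by rewrite ler_wpM2r ?shape_ge0// wM// -ai vtx_nbrs.
Qed.

Lemma fe_fun_patch_ge w i M x : patch i x ->
  (forall j, j \in nbrs i -> M <= w j) -> M <= fe_fun phi w x.
Proof.
move=> [e [a ai] [xi Kxi <-]] wM; rewrite fe_fun_cell// -[M]mulr1.
rewrite -(sum_shape c xi) mulr_sumr; apply: ler_sum => b _.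
by rewrite ler_wpM2r ?shape_ge0// wM// -ai vtx_nbrs.
Qed.

Lemma nodal_basis01 i x : closure Omega x -> 0 <= phi i x <= 1.
Proof.
move=> /closure_cell[e [xi [Kxi <-]]]; rewrite nodal_basis_cell//.
rewrite sumr_ge0/=; last by move=> a _; rewrite mulr_ge0 ?shape_ge0.
rewrite -[leRHS](sum_shape c xi); apply: ler_sum => a _.
by case: (i == _); rewrite ?mul1r ?mul0r ?lexx ?shape_ge0.
Qed.

(** In a cell containing i, the basis functions of the neighbours of i form a
    partition of unity; in the other cells phi i vanishes. *)
Lemma sum_grad_nbrs i x k :
  (\sum_(j in nbrs i) grad Th (phi j) x ord0 k) * phi i x = 0.
Proof.
have [[e xe]|xe] := pselect (exists e : elt Th, (cell e)^° x); last first.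
  by rewrite big1 ?mul0r// => j _; rewrite grad_exterior.
have [[a ai]|ni] := pselect (exists a, vtx e a = i); last first.
  have [xi Kxi <-] := interior_subset xe; rewrite nodal_basis_cell//.
  rewrite [X in _ * X]big1 ?mulr0// => a _.
  by case: eqP => [ia|]; rewrite ?mul0r//; case: ni; exists a.
rewrite (eq_bigr (fun j => 'D_(delta_mx ord0 k) (phi j) x)); last first.
  by move=> j _; rewrite (grad_interior _ _ xe).
have [fphi _] := hphi.
rewrite big_enum_val -derive_sum; last by move=> j; exact: derivable_fe xe.
have -> : 'D_(delta_mx ord0 k) (\sum_(j < #|nbrs i|) phi (enum_val j)) x =
    'D_(delta_mx ord0 k) (cst (1 : R)) x; last by rewrite derive_cst mul0r.
apply: near_eq_derive.
apply: filterS (nbhs_interior xe) => y /interior_subset[xi Kxi <-].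
rewrite fct_sumE -(big_enum_val (fun j => phi j (cellmap e xi))).
under eq_bigr do rewrite nodal_basis_cell//.
rewrite exchange_big/= /cst -[RHS](sum_shape c xi); apply: eq_bigr => b _.
rewrite (bigD1 (vtx e b)) -?ai ?vtx_nbrs//= eqxx mul1r big1 ?addr0//.
by move=> j /andP[_ /negbTE ->]; rewrite mul0r.
Qed.

End finite_elements.

(** * Integrals over an open set *)

Section integral_on_theory.
Context (R : realType) (d : nat).
Local Notation X := 'rV[R]_d.
Local Notation pot := (@point_of_tuple R d).
Context (Omega : set X) (oO : open Omega).
Local Notation D := (pot @^-1` Omega).

Definition integrable_on (f : X -> R) :=
  (leb R d).-integrable D (EFin \o (f \o pot)).

Lemma leb_bounded : bounded_set Omega -> (leb R d D < +oo)%E.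
Proof.
move=> [M [_ OM]].
have M1 : 0 < `|M| + 2 by rewrite ltr_pwDr// ltr0n.
apply: (@le_lt_trans _ _ (leb R d (pot @^-1` ball 0 (`|M| + 2)))).
  apply: le_measure; rewrite ?inE; first exact: measurable_preimage_open.
    exact: measurable_preimage_ball.
  move=> t Ot; rewrite /= -ball_normE/= sub0r normrN.
  apply: (@le_lt_trans _ _ (`|M| + 1)); last by lra.
  by apply: (OM (`|M| + 1)) => //; have := ler_norm M; lra.
by have /andP[] := @leb_ball R d 0 _ M1.
Qed.

Lemma bounded_integrable_on (f : X -> R) M : bounded_set Omega ->
  measurable_fun D (f \o pot) -> (forall x, Omega x -> `|f x| <= M) ->
  integrable_on f.
Proof.
move=> bO mf fM; apply: measurable_bounded_integrable => //.
- exact: measurable_preimage_open.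
- exact: leb_bounded.
exists M; split; first exact: num_real.
by move=> y My t Ot /=; apply: le_trans (ltW My); exact: fM.
Qed.

Lemma integral_on_sum (I : Type) (r : seq I) (P : pred I) (f : I -> X -> R) :
  (forall i, integrable_on (f i)) ->
  integral_on Omega (fun x => \sum_(i <- r | P i) f i x) =
  \sum_(i <- r | P i) integral_on Omega (f i).
Proof.
move=> fi; have mD := measurable_preimage_open oO.
rewrite /integral_on; elim: r => [|i r IH].
  under eq_Rintegral do rewrite big_nil.
  by rewrite big_nil Rintegral_cst// mul0r.
rewrite big_cons; under eq_Rintegral do rewrite big_cons.
case: ifP => _ //; rewrite RintegralD ?IH//; first exact: fi.
rewrite (_ : _ \o _ = fun t => (\sum_(i <- r | P i) (EFin \o (f i \o pot)) t)%E).
  by apply: integrable_sum => // j _; exact: fi.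
by apply/funext => t /=; rewrite sumEFin.
Qed.

Lemma integral_on0 : integral_on Omega (fun=> 0 : R) = 0.
Proof.
rewrite /integral_on Rintegral_cst ?mul0r//; exact: measurable_preimage_open.
Qed.

(** The point x0 may lie on the boundary of Omega, but points of Omega are
    arbitrarily close to it; f exceeds f x0 / 2 on a ball around one of
    them, and balls have positive measure. *)
Lemma integral_on_gt0 (f : X -> R) x0 : integrable_on f ->
  (forall x, Omega x -> 0 <= f x) ->
  closure Omega x0 -> {within closure Omega, continuous f} -> 0 < f x0 ->
  0 < integral_on Omega f.
Proof.
move=> fi f0 Ox0 /subspace_continuousP cf fx0.
have mD := measurable_preimage_open oO.
pose h := f x0 / 2; have h0 : 0 < h by rewrite /h; lra.
have /nbhs_interior nV : nbhs x0 [set y | closure Omega y -> h < f y].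
  have : nbhs (f x0) [set y | h < y].
    by apply: open_nbhs_nbhs; split; [exact: open_gt|rewrite /= /h; lra].
  move=> /(cf x0 Ox0); rewrite /nbhs/= /within/=.
  by apply: filterS => y hy Oy; exact: hy.
have [z [Oz Vz]] := Ox0 _ nV.
have [r /= r0 rOV] : exists2 r, 0 < r & ball z r `<=` Omega `&` [set y | h < f y].
  have : nbhs z (Omega `&` [set y | closure Omega y -> h < f y]).
    by apply: filterI => //; exact: open_nbhs_nbhs.
  move=> /nbhs_ballP[r r0 rO]; exists r => // y /rO[Oy hy]; split => //.
  exact/hy/subset_closure.
have mB := @measurable_preimage_ball R d z r r0.
have /andP[lB0 lBoo] := @leb_ball R d z r r0.
have /integrableP[mf _] := fi.
rewrite /integral_on /Rintegral fine_gt0//; apply/andP; split; last first.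
  by rewrite ltey_eq integrable_fin_num.
apply: (@lt_le_trans _ _ (\int[leb R d]_(t in pot @^-1` ball z r) h%:E)%E).
  by rewrite integral_cst// mule_gt0.
apply: (@le_trans _ _ (\int[leb R d]_(t in pot @^-1` ball z r) (f (pot t))%:E)%E).
  apply: ge0_le_integral => //.
  - by move=> t _; rewrite lee_fin ltW.
  - by apply: measurable_funS mf => // t /rOV[].
  - by move=> t /rOV[_ /ltW]; rewrite lee_fin.
apply: ge0_subset_integral => //.
- by move=> t Ot; rewrite lee_fin f0.
- by move=> t /rOV[].
Qed.

End integral_on_theory.

(** * The scheme *)

Lemma le_coord_norm (R : realType) (d : nat) (x : 'rV[R]_d) k :
  `|x ord0 k| <= `|x|.
Proof.
rewrite [leRHS]/Num.norm/= mx_normrE.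
by apply/bigmax_geP; right; exists (ord0, k).
Qed.

Section led.
Context (R : realType) (d : nat) (c : cell_kind) (Th : mesh R d c).
Local Notation X := 'rV[R]_d.
Local Notation pot := (@point_of_tuple R d).
Local Notation patch := (@Defs.patch R d c Th).
Context (Omega : set X) (hOmega : bounded_domain Omega).
Context (hTh : conforming_mesh Th Omega).
Context (phi : node Th -> X -> R) (hphi : nodal_basis Omega phi).
Context (f df : R -> X) (hdf : flux_derivative f df).
Context (xsym : node Th -> node Th -> X) (hxsym : symmetric_points xsym).
Context (q : R).
Implicit Types (i j : node Th) (w v : node Th -> R).

Local Notation Fm := (Fmat Omega phi df).
Local Notation al := (alpha phi xsym q).
Local Notation nuo := (nu_off Omega phi df xsym q).

Let oO : open Omega. Proof. by case: hOmega. Qed.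
Let bO : bounded_set Omega. Proof. by case: hOmega. Qed.

Lemma fe_fun_continuous w : {in Omega, continuous (fe_fun phi w)}.
Proof.
move=> x Ox; rewrite /fe_fun; apply: (@cvg_bigsum R X (nbhs x) _) => j _.
apply: cvgM; first exact: cvg_cst.
by have [fphi _] := hphi; exact: (fe_space_continuous oO (fphi j) Ox).
Qed.

Lemma integrable_convection w i j : integrable_on Omega (fun x =>
  (\sum_k df (fe_fun phi w x) ord0 k * grad Th (phi j) x ord0 k) * phi i x).
Proof.
have [mdf [C dfC] _] := hdf; have [fphi _] := hphi.
have /choice[M MP] k := bounded_grad hTh k (fphi j).
apply: (bounded_integrable_on oO (M := \sum_k C * M k) bO).
  apply: measurable_funM; last first.
    exact: (measurable_fun_continuous_open oO (fe_space_continuous oO (fphi i))).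
  apply: measurable_sum => k; apply: measurable_funM.
    apply: (measurableT_comp (mdf k)).
    exact: (measurable_fun_continuous_open oO (@fe_fun_continuous w)).
  by apply: measurable_funTS; exact: (measurable_grad hTh k (fphi j)).
move=> x Ox; rewrite normrM.
have /andP[p0 p1] := nodal_basis01 hTh hphi i (subset_closure Ox).
rewrite -[leRHS]mulr1; apply: ler_pM => //; last by rewrite ger0_norm.
apply: le_trans (ler_norm_sum _ _ _) _; apply: ler_sum => k _.
rewrite normrM; apply: ler_pM => //.
exact: le_trans (le_coord_norm _ _) (dfC _).
Qed.

Lemma sum_Fmat w i : \sum_(j in nbrs i) Fm w i j = 0.
Proof.
rewrite /Fmat /l2 -(integral_on_sum oO); last by move=> j; exact: integrable_convection.
rewrite -[RHS](integral_on0 oO); congr integral_on; apply/funext => x.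
rewrite -mulr_suml exchange_big/= mulr_suml big1// => k _.
by rewrite -mulr_sumr -mulrA (sum_grad_nbrs hTh hphi) mulr0.
Qed.

Lemma lumped_mass_gt0 i : 0 < l2 Omega (fun=> 1) (phi i).
Proof.
have [fphi dphi] := hphi; have [cphi _] := fphi i.
have p01 x : Omega x -> 0 <= phi i x <= 1.
  by move=> /subset_closure; exact: nodal_basis01.
rewrite /l2; under [X in integral_on _ X]eq_fun do rewrite mul1r.
apply: (@integral_on_gt0 _ _ _ oO (phi i) (pos i)) => //.
- apply: (bounded_integrable_on oO (M := 1) bO).
    exact: (measurable_fun_continuous_open oO (fe_space_continuous oO (fphi i))).
  by move=> x /p01/andP[p0 p1]; rewrite ger0_norm.
- by move=> x /p01/andP[].
- have [_ /(_ i)[e [a <-]] _ -> _] := hTh.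
  by exists e => //; exact: cell_vertex.
- by rewrite dphi eqxx.
Qed.

Lemma Adet_ge0 w i j : 0 <= Adet phi xsym w i j.
Proof.
rewrite /Adet mulr_ge0 ?invr_ge0// addr_ge0// divr_ge0//.
  by rewrite /rdist sqrtr_ge0.
by rewrite /rdist_sym sqrtr_ge0.
Qed.

(** When the J_ij share one sign s there is no cancellation in their sum, so
    the quotient defining alpha is 1, and so are its powers. *)
Lemma alpha_eq1 w i (s : R) : `|s| = 1 ->
  (forall j, j \in (nbrs i :\ i)%SET ->
    Jdet phi xsym w i j = s * (2 * Adet phi xsym w i j)) ->
  \sum_(j in (nbrs i :\ i)%SET) Adet phi xsym w i j != 0 -> al w i = 1.
Proof.
move=> s1 JA A0; rewrite /alpha A0.
have SA : \sum_(j in (nbrs i :\ i)%SET) 2 * Adet phi xsym w i j != 0.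
  by rewrite -mulr_sumr mulf_neq0.
rewrite (eq_bigr _ JA) -[X in `|X|]mulr_sumr normrM s1 mul1r ger0_norm.
  by rewrite divff// powR1.
by rewrite sumr_ge0// => j _; rewrite mulr_ge0// Adet_ge0.
Qed.

(** Patches are closed, so they contain their boundary. *)
Lemma xsym_patch i j : j \in (nbrs i :\ i)%SET -> patch i (xsym i j).
Proof.
by move=> /hxsym[_ [+ _] _]; rewrite -(closure_id _).1//; exact: closed_patch.
Qed.

Lemma alpha_maximum w i : is_maximum w i ->
  \sum_(j in (nbrs i :\ i)%SET) Adet phi xsym w i j != 0 -> al w i = 1.
Proof.
move=> wi; apply: (alpha_eq1 (s := -1)); first by rewrite normrN1.
move=> j ij; have us := fe_fun_patch_le hphi (xsym_patch ij) wi.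
have /setD1P[_ /wi wj] := ij.
rewrite /Jdet /Adet /usym !ler0_norm ?subr_le0// mulVKf// mulN1r.
by rewrite !mulNr opprD !opprK.
Qed.

Lemma alpha_minimum w i : is_minimum w i ->
  \sum_(j in (nbrs i :\ i)%SET) Adet phi xsym w i j != 0 -> al w i = 1.
Proof.
move=> wi; apply: (alpha_eq1 (s := 1)); first by rewrite normr1.
move=> j ij; have us := fe_fun_patch_ge hphi (xsym_patch ij) wi.
have /setD1P[_ /wi wj] := ij.
by rewrite /Jdet /Adet /usym !ger0_norm ?subr_ge0// mulVKf// mul1r.
Qed.

(** The zero row sum of F replaces u_j by u_j - u_i in the convection term,
    while B is built with zero row sums. *)
Lemma nodal_balance w v i : scheme_eq Omega phi df xsym q (fun=> 0) w v ->
  al w i = 1 ->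
  l2 Omega (fun=> 1) (phi i) * v i =
  \sum_(j in (nbrs i :\ i)%SET) (nuo w i j - Fm w i j) * (w j - w i).
Proof.
move=> /(_ i) + a1; have ii := nodes_nbrs hTh i.
have l20 (g : X -> R) : l2 Omega (fun=> 0) g = 0.
  rewrite /l2; under [X in integral_on _ X]eq_fun do rewrite mul0r.
  exact: integral_on0.
rewrite l20 => eq0.
have ME : \sum_(j in nbrs i) Mmat Omega phi xsym q w i j * v j =
    l2 Omega (fun=> 1) (phi i) * v i.
  rewrite (big_setD1 i)//= big1 ?addr0 => [|j /setD1P[ji _]].
    by rewrite /Mmat a1 subrr mul0r add0r mul1r eqxx.
  by rewrite /Mmat a1 subrr mul0r add0r mul1r eq_sym (negbTE ji) l20 mul0r.
have FE : \sum_(j in nbrs i) Fm w i j * w j =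
    \sum_(j in (nbrs i :\ i)%SET) Fm w i j * (w j - w i).
  have -> : \sum_(j in nbrs i) Fm w i j * w j =
      \sum_(j in nbrs i) Fm w i j * (w j - w i).
    under [RHS]eq_bigr do rewrite mulrBr.
    by rewrite sumrB -mulr_suml sum_Fmat mul0r subr0.
  by rewrite (big_setD1 i)//= subrr mulr0 add0r.
have BE : \sum_(j in nbrs i) Bmat Omega phi df xsym q w i j * w j =
    - \sum_(j in (nbrs i :\ i)%SET) nuo w i j * (w j - w i).
  rewrite (big_setD1 i)//= /Bmat ii /nu eqxx -sumrN.
  rewrite [X in X + _](_ : _ =
      \sum_(j in (nbrs i :\ i)%SET) nuo w i j * w i); last first.
    by rewrite -mulr_suml /= mulr1n; ring.
  rewrite -big_split/=; apply: eq_bigr => j /setD1P[ji ->].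
  by rewrite eq_sym (negbTE ji) mulr0n; ring.
move: eq0; rewrite ME; under eq_bigr do rewrite /Kmat mulrDl.
rewrite big_split/= FE BE.
under [X in _ -> _ = X]eq_bigr do rewrite mulrBl.
by rewrite sumrB => eq0; lra.
Qed.

Lemma nu_off_ge w i j : al w i = 1 -> Fm w i j <= nuo w i j.
Proof. by move=> a1; rewrite /nu_off a1 mul1r !le_max lexx. Qed.

Lemma scheme_LED w v i : scheme_eq Omega phi df xsym q (fun=> 0) w v ->
  \sum_(j in (nbrs i :\ i)%SET) Adet phi xsym w i j != 0 -> LED_at w v i.
Proof.
move=> sch A0; have m0 := lumped_mass_gt0 i; split => wi.
- have a1 := alpha_maximum wi A0.
  rewrite -(pmulr_rle0 _ m0) (nodal_balance sch a1) sumr_le0// => j /setD1P[_ /wi wj].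
  by rewrite mulr_ge0_le0// ?subr_ge0 ?nu_off_ge// subr_le0.
- have a1 := alpha_minimum wi A0.
  rewrite -(pmulr_rge0 _ m0) (nodal_balance sch a1) sumr_ge0// => j /setD1P[_ /wi wj].
  by rewrite mulr_ge0// subr_ge0// nu_off_ge.
Qed.

End led.

Theorem theorem4p2 (R : realType) (d : nat) (hd : d = 2%N \/ d = 3%N)
    (Omega : set 'rV[R]_d) (hOmega : bounded_domain Omega)
    (c : cell_kind) (Th : mesh R d c) (hTh : conforming_mesh Th Omega)
    (phi : node Th -> 'rV[R]_d -> R) (hphi : nodal_basis Omega phi)
    (xsym : node Th -> node Th -> 'rV[R]_d) (hxsym : symmetric_points xsym)
    (f : R -> 'rV[R]_d) (hf : lipschitz f)
    (df : R -> 'rV[R]_d) (hdf : flux_derivative f df)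
    (q : R) (hq : 0 < q) (T : R) (hT : 0 < T) :
  (forall u du : R -> node Th -> R,
     semidiscrete_solution Omega phi df xsym q T (fun _ _ => 0) u du ->
     forall t : R, 0 < t <= T ->
     forall i : node Th,
       \sum_(j in (nbrs i :\ i)%SET) Adet phi xsym (u t) i j != 0 ->
       LED_at (u t) (du t) i)
  /\
  (forall (N : nat) (tn : nat -> R) (u : nat -> node Th -> R),
     time_partition T N tn ->
     discrete_solution Omega phi df xsym q N tn (fun _ _ => 0) u ->
     forall n : nat, (n < N)%N ->
     forall i : node Th,
       \sum_(j in (nbrs i :\ i)%SET) Adet phi xsym (u n.+1) i j != 0 ->
       LED_at (u n.+1) (delta_t tn u n) i).
Proof.
have LED := scheme_LED hOmega hTh hphi hdf hxsym.
split=> [u du sol t tT i Ai|N tn u _ sol n nN i Ai].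
  by have [_ eq_t] := sol t tT; exact: LED eq_t Ai.
exact: LED (sol n nN) Ai.
Qed.
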